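(* Let $w\in F$ be a positive word, and let $p_1/q_1$ and $p_2/q_2$ be rational numbers. Then $R(w,p_1/q_1-,p_2/q_2)$ is the supremum of $\mathrm{rot}^\sim(\rho(w))$ over all homomorphisms $\rho:F\to\mathrm{Homeo}^+(S^1)^\sim$ with $\rho(a)$ conjugate to the rotation $R_{p_1/q_1}$ and $\mathrm{rot}^\sim(\rho(b))=p_2/q_2$ (and similarly with the roles of $a$ and $b$ interchanged), and $R(w,p_1/q_1-,p_2/q_2-)$ is the supremum of $\mathrm{rot}^\sim(\rho(w))$ over all homomorphisms $\rho:F\to\mathrm{Homeo}^+(S^1)^\sim$ with $\rho(a)$ conjugate to $R_{p_1/q_1}$ and $\rho(b)$ conjugate to $R_{p_2/q_2}$.
   Context: $F$ is the free group on two generators $a,b$. A word in $F$ is positive if it contains only the letters $a$ and $b$, and no $a^{-1}$ or $b^{-1}$. $\mathrm{Homeo}^+(S^1)^\sim$ denotes the group of increasing homeomorphisms of $\mathbb{R}$ commuting with $x\mapsto x+1$, $R_\theta\in\mathrm{Homeo}^+(S^1)^\sim$ is the translation $x\mapsto x+\theta$, and $\mathrm{rot}^\sim(\varphi)=\lim_{n\to\infty}(\varphi^n(x)-x)/n\in\mathbb{R}$ is the real-valued Poincaré rotation number. Conjugacy is in $\mathrm{Homeo}^+(S^1)^\sim$. For $r,s\in\mathbb{R}$, $R(w,r,s)$ denotes the supremum of $\mathrm{rot}^\sim(\rho(w))$ over all homomorphisms $\rho:F\to \mathrm{Homeo}^+(S^1)^\sim$ with $\mathrm{rot}^\sim(\rho(a))=r$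 and $\mathrm{rot}^\sim(\rho(b))=s$. For $w$ positive, $R(w,\cdot,\cdot)$ is nondecreasing in each variable, and one defines the limits from below: $R(w,r-,s)=\lim_{r'\to r,\,r'<r}R(w,r',s)$, $R(w,r,s-)=\lim_{s'\to s,\,s'<s}R(w,r,s')$, and $R(w,r-,s-)=\lim R(w,r',s')$ as $r'\to r$, $s'\to s$ with $r'<r$, $s'<s$. *)

(* Defs.v *)
From HB Require Import structures.
From mathcomp Require Import all_boot all_order all_algebra.
From mathcomp Require Import all_classical all_reals all_analysis.
Import Order.TTheory GRing.Theory Num.Theory numFieldNormedType.Exports.
From mathcomp Require Import lra.

Set Implicit Arguments.
Unset Strict Implicit.
Unset Printing Implicit Defensive.

Local Open Scope classical_set_scope.
Local Open Scope ring_scope.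

Section FreeGroup.
Variable X : choiceType.

(* (x, false) stands for x and (x, true) for x^-1 *)
Definition letter : Type := X * bool.
HB.instance Definition _ := Choice.on letter.

Definition linv (l : letter) : letter := (l.1, ~~ l.2).

Definition reduced (s : seq letter) : bool :=
  sorted (fun l m => m != linv l) s.

Record freegroup : Type := Freegroup {
  fgword :> seq letter;
  fgword_reduced : reduced fgword
}.
HB.instance Definition _ := [isSub for fgword].
HB.instance Definition _ := [Choice of freegroup by <:].

(* left multiplication of a reduced word by one letter, then by a word *)
Definition lcons (l : letter) (s : seq letter) : seq letter :=
  if s is m :: s' then if m == linv l then s' else l :: s else [:: l].

Definition lcat (s t : seq letter) : seq letter := foldr lcons t s.

Lemma linvK : involutive linv.
Proof. by case=> x b; rewrite /linv negbK. Qed.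

Lemma reduced_lcons l s : reduced s -> reduced (lcons l s).
Proof.
case: s => [//|m s] /= rs; case: ifPn => [_|ml]; first exact: path_sorted rs.
by rewrite /= ml.
Qed.

Lemma reduced_lcat s t : reduced t -> reduced (lcat s t).
Proof. by move=> rt; elim: s => //= l s; exact: reduced_lcons. Qed.

Lemma lconsK l s : reduced s -> lcons l (lcons (linv l) s) = s.
Proof.
case: s => [|m s] /=; first by rewrite eqxx.
rewrite linvK; case: eqVneq => [->|_] /=; last by rewrite eqxx.
by case: s => [//|m' s] /= /andP[/negbTE ->].
Qed.

Lemma lcat_lcons l s t : reduced t -> lcat (lcons l s) t = lcons l (lcat s t).
Proof.
move=> rt; case: s => [//|m s] /=; case: eqVneq => [->|_] //.
by rewrite lconsK//; exact: reduced_lcat.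
Qed.

Lemma lcat_reduced s : reduced s -> lcat s [::] = s.
Proof.
elim: s => //= l s IH rs; rewrite IH; last exact: path_sorted rs.
by case: s rs {IH} => //= m s /andP[/negbTE ->].
Qed.

Lemma lcatA s t u : reduced u -> lcat s (lcat t u) = lcat (lcat s t) u.
Proof. by move=> ru; elim: s => //= l s ->; rewrite lcat_lcons. Qed.

Lemma reduced_inv s : reduced s -> reduced (rev (map linv s)).
Proof.
rewrite /reduced rev_sorted sorted_map; apply: sub_sorted => l m /=.
by rewrite linvK eq_sym.
Qed.

Lemma lcat_rcons s l t : lcat (rcons s l) t = lcat s (lcons l t).
Proof. by rewrite /lcat foldr_rcons. Qed.

Lemma lcatVs s t : reduced t -> lcat (rev (map linv s)) (lcat s t) = t.
Proof.
move=> rt; elim: s => //= l s IH; rewrite rev_cons lcat_rcons.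
by rewrite -{2}[l]linvK lconsK//; exact: reduced_lcat.
Qed.

Definition fg1 : freegroup := Freegroup (isT : reduced [::]).
Definition fgmul (u v : freegroup) : freegroup :=
  Freegroup (reduced_lcat u (fgword_reduced v)).
Definition fginv (u : freegroup) : freegroup :=
  Freegroup (reduced_inv (fgword_reduced u)).

Fact fgmulA : associative fgmul.
Proof. by move=> u v w; apply/val_inj/lcatA/fgword_reduced. Qed.
Fact fgmul1g : left_id fg1 fgmul.
Proof. by move=> u; exact: val_inj. Qed.
Fact fgmulg1 : right_id fg1 fgmul.
Proof. by move=> u; apply/val_inj/lcat_reduced/fgword_reduced. Qed.
Fact fgmulVg : left_inverse fg1 fginv fgmul.
Proof.
move=> u; apply/val_inj => /=.
by rewrite -{2}(lcat_reduced (fgword_reduced u)) lcatVs.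
Qed.
Fact fgmulgV : right_inverse fg1 fginv fgmul.
Proof.
move=> u; have <- : fginv (fginv u) = u by
  apply/val_inj; rewrite /= map_rev revK -map_comp map_id_in// => l _ /=;
  rewrite linvK.
have -> : fginv (fginv (fginv u)) = fginv u by
  apply/val_inj; rewrite /= map_rev revK -map_comp map_id_in// => l _ /=;
  rewrite linvK.
exact: fgmulVg.
Qed.

HB.instance Definition _ :=
  isGroup.Build freegroup fgmulA fgmul1g fgmulg1 fgmulVg fgmulgV.

Definition fgen (x : X) : freegroup := Freegroup (isT : reduced [:: (x, false)]).

Definition positive_word (w : freegroup) : bool :=
  all (fun l : letter => ~~ l.2) (fgword w).

End FreeGroup.

Notation F2 := (freegroup bool).
Definition gen_a : F2 := fgen false.
Definition gen_b : F2 := fgen true.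

Section HomeoS1.
Variable R : realType.

Definition homeomorphism (f : R -> R) : Prop :=
  exists g : R -> R, [/\ cancel f g, cancel g f, continuous f & continuous g].

Definition homeoS1_axiom (f : R -> R) : Prop :=
  [/\ homeomorphism f, {homo f : x y / x < y} & forall x, f (x + 1) = f x + 1].

(* Homeo^+(S^1)^~ *)
Record homeoS1 : Type := HomeoS1 {
  homeoS1_fun :> R -> R;
  homeoS1_prop : `[< homeoS1_axiom homeoS1_fun >]
}.
HB.instance Definition _ := [isSub for homeoS1_fun].
HB.instance Definition _ := [Choice of homeoS1 by <:].

Lemma homeoS1P (f : homeoS1) : homeoS1_axiom f.
Proof. exact/asboolP/homeoS1_prop. Qed.

Lemma homeoS1_eq (f g : homeoS1) : (forall x, f x = g x) -> f = g.
Proof. by move=> fg; apply/val_inj/funext. Qed.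

Fact homeoS1_axiom_id : homeoS1_axiom idfun.
Proof. by split => //; exists idfun; split => // x; exact: cvg_id. Qed.

Fact homeoS1_axiom_comp f g :
  homeoS1_axiom f -> homeoS1_axiom g -> homeoS1_axiom (f \o g).
Proof.
move=> [[f' [fK f'K cf cf']] f_lt f1] [[g' [gK g'K cg cg']] g_lt g1]; split.
- exists (g' \o f'); split.
  + exact: can_comp.
  + exact: can_comp.
  + by move=> x; apply: continuous_comp; [exact: cg|exact: cf].
  + by move=> x; apply: continuous_comp; [exact: cf'|exact: cg'].
- by move=> x y /g_lt/f_lt.
- by move=> x /=; rewrite g1 f1.
Qed.

Fact homeoS1_axiom_inv f : homeoS1_axiom f ->
  exists g, [/\ homeoS1_axiom g, cancel f g & cancel g f].
Proof.
move=> [[g [fK gK cf cg]] f_lt f1]; exists g; split => //; split.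
- by exists f.
- have fle := ltW_homo f_lt.
  by move=> x y xy; rewrite ltNge; apply/negP => /fle; rewrite !gK leNgt xy.
- by move=> x; apply: (can_inj fK); rewrite gK f1 gK.
Qed.

Definition homeoS1_one : homeoS1 := HomeoS1 (asboolT homeoS1_axiom_id).
(* the product is composition: (f * g) x = f (g x) *)
Definition homeoS1_mul (f g : homeoS1) : homeoS1 :=
  HomeoS1 (asboolT (homeoS1_axiom_comp (homeoS1P f) (homeoS1P g))).

Fact homeoS1_inv_ex (f : homeoS1) :
  {g : homeoS1 | cancel f g /\ cancel g f}.
Proof.
apply: cid; have [g [gP fK gK]] := homeoS1_axiom_inv (homeoS1P f).
by exists (HomeoS1 (asboolT gP)).
Qed.
Definition homeoS1_inv (f : homeoS1) : homeoS1 := sval (homeoS1_inv_ex f).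

Fact homeoS1_mulA : associative homeoS1_mul.
Proof. by move=> f g h; exact: homeoS1_eq. Qed.
Fact homeoS1_mul1g : left_id homeoS1_one homeoS1_mul.
Proof. by move=> f; exact: homeoS1_eq. Qed.
Fact homeoS1_mulg1 : right_id homeoS1_one homeoS1_mul.
Proof. by move=> f; exact: homeoS1_eq. Qed.
Fact homeoS1_mulVg : left_inverse homeoS1_one homeoS1_inv homeoS1_mul.
Proof. by move=> f; apply: homeoS1_eq => x; exact: (svalP (homeoS1_inv_ex f)).1. Qed.
Fact homeoS1_mulgV : right_inverse homeoS1_one homeoS1_inv homeoS1_mul.
Proof. by move=> f; apply: homeoS1_eq => x; exact: (svalP (homeoS1_inv_ex f)).2. Qed.

HB.instance Definition _ := isGroup.Build homeoS1
  homeoS1_mulA homeoS1_mul1g homeoS1_mulg1 homeoS1_mulVg homeoS1_mulgV.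

Fact homeoS1_axiom_translation (t : R) : homeoS1_axiom (fun x => x + t).
Proof.
split.
- exists (fun x => x - t); split.
  + by move=> x; rewrite addrK.
  + by move=> x; rewrite subrK.
  + by move=> x; apply: cvgD; [exact: cvg_id|exact: cvg_cst].
  + by move=> x; apply: cvgB; [exact: cvg_id|exact: cvg_cst].
- by move=> x y; rewrite ltrD2r.
- by move=> x; rewrite addrAC.
Qed.
Definition translation (t : R) : homeoS1 :=
  HomeoS1 (asboolT (homeoS1_axiom_translation t)).

Definition conjugated (f g : homeoS1) : Prop := exists h : homeoS1, f = (g ^ h)%g.

(* The limit does not depend on the base point 0, see rot_cvg. *)
Definition rotnum (f : homeoS1) : R :=
  limn (fun n : nat => ((f ^+ n)%g 0 - 0) / n%:R).

(* R(w, r, s); the set is nonempty (translations) and bounded above, so the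
   real-valued sup never takes its default value *)
Definition maxrot (w : F2) (r s : R) : R :=
  sup [set rotnum (rho w) | rho in
    [set rho : {multiplicative F2 -> homeoS1} |
      rotnum (rho gen_a) = r /\ rotnum (rho gen_b) = s]].

Lemma homeoS1_addz (f : homeoS1) x (z : int) : f (x + z%:~R) = f x + z%:~R.
Proof.
have [_ _ f1] := homeoS1P f.
have fn (n : nat) y : f (y + n%:R) = f y + n%:R.
  by elim: n => [|n IH]; rewrite ?addr0// -natr1 !addrA f1 IH.
case: z => n; first exact: fn.
by rewrite NegzE rmorphN /= -{2}[x](subrK n.+1%:R) fn addrK.
Qed.

Lemma homeoS1_displacement (f : homeoS1) x y :
  `|(f x - x) - (f y - y)| <= 1.
Proof.
pose z := Num.floor (x - y); pose x' := x - z%:~R.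
have -> : f x - x = f x' - x'.
  by rewrite -{1 2}[x](subrK z%:~R) -/x' homeoS1_addz; lra.
have [_ f_lt f1] := homeoS1P f; have fle := ltW_homo f_lt.
have /andP[] := floor_itv (x - y); rewrite -/z intrD1 => zl zu.
have h1 : f y <= f x' by apply: fle; rewrite /x'; lra.
have h2 : f x' <= f y + 1 by rewrite -f1; apply: fle; rewrite /x'; lra.
by rewrite ler_norml; apply/andP; split; move: zl zu h1 h2; rewrite /x'; lra.
Qed.

Lemma homeoS1_expgM (f : homeoS1) (m n : nat) :
  `|(f ^+ (n * m))%g 0 - n%:R * (f ^+ m)%g 0| <= n%:R.
Proof.
elim: n => [|n IH]; first by rewrite mul0n mul0r subr0 normr0.
rewrite mulSn expgnDr.
have := homeoS1_displacement (f ^+ m)%g ((f ^+ (n * m))%g 0) 0.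
rewrite [X in _ -> `|X - _| <= _](_ : _ = (f ^+ m)%g ((f ^+ (n * m))%g 0))//.
move: IH; rewrite -natr1 !ler_norml => /andP[? ?] /andP[? ?].
by apply/andP; split; lra.
Qed.

Lemma rot_seq_cauchy (f : homeoS1) (m n : nat) : (0 < m)%N -> (0 < n)%N ->
  `|(f ^+ n)%g 0 / n%:R - (f ^+ m)%g 0 / m%:R| <= n%:R^-1 + m%:R^-1.
Proof.
move=> m0 n0.
have H (k l : nat) : (0 < k)%N -> (0 < l)%N ->
    `|(f ^+ (k * l))%g 0 / (k * l)%:R - (f ^+ l)%g 0 / l%:R| <= l%:R^-1.
  move=> k0 l0; have kR : 0 < k%:R :> R by rewrite ltr0n.
  have lR : 0 < l%:R :> R by rewrite ltr0n.
  rewrite natrM.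
  have -> : (f ^+ (k * l))%g 0 / (k%:R * l%:R) - (f ^+ l)%g 0 / l%:R =
      ((f ^+ (k * l))%g 0 - k%:R * (f ^+ l)%g 0) / (k%:R * l%:R).
    by rewrite mulrBl -mulf_div divff ?gt_eqF// mul1r.
  rewrite normrM normfV (gtr0_norm (mulr_gt0 kR lR)) ler_pdivrMr ?mulr_gt0//.
  rewrite mulrCA mulVf ?gt_eqF// mulr1; exact: homeoS1_expgM.
have := H _ _ m0 n0; have := H _ _ n0 m0; rewrite (mulnC m n).
rewrite !ler_norml => /andP[? ?] /andP[? ?]; apply/andP; split; lra.
Qed.

Lemma rot_cvg (f : homeoS1) x :
  (fun n : nat => ((f ^+ n)%g x - x) / n%:R) @ \oo --> rotnum f.
Proof.
have inv0 : (fun n : nat => (n%:R : R)^-1) @ \oo --> (0 : R).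
  by rewrite -(cvg_shiftS (fun n => (n%:R : R)^-1)); exact: cvg_harmonic.
have c0 : cvgn (fun n : nat => ((f ^+ n)%g 0 - 0) / n%:R).
  apply/cauchy_cvgP/cauchy_exP => e e0.
  have e4 : 0 < e / 2 by rewrite divr_gt0.
  have /cvgrPdist_lt/(_ _ e4) [N _ NP] := inv0.
  exists ((f ^+ N.+1)%g 0 / N.+1%:R); exists N.+1 => // n /= Nn.
  rewrite -ball_normE /= subr0.
  apply: (le_lt_trans (rot_seq_cauchy f _ _)) => //.
    by rewrite (leq_trans _ Nn).
  have hn := NP n (ltnW Nn); have hN := NP N.+1 (leqnSn N).
  rewrite /= sub0r normrN ger0_norm ?invr_ge0// in hn.
  rewrite /= sub0r normrN ger0_norm ?invr_ge0// in hN.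
  by rewrite (splitr e) ltrD.
rewrite -[rotnum f]addr0.
have -> : (fun n : nat => ((f ^+ n)%g x - x) / n%:R) =
    (fun n : nat => ((f ^+ n)%g 0 - 0) / n%:R +
      (((f ^+ n)%g x - x) - ((f ^+ n)%g 0 - 0)) / n%:R).
  by apply/funext => n; rewrite -mulrDl; congr (_ / _); lra.
apply: cvgD => //.
apply/cvgr0Pnorm_lt => e e0.
have /cvgr0Pnorm_lt/(_ _ e0) := inv0; apply: filterS => n ne.
rewrite normrM; apply: le_lt_trans ne.
by rewrite -[leRHS]mul1r ler_wpM2r// homeoS1_displacement.
Qed.

End HomeoS1.

(* Main.v *)
(* If rot(f) < p/q, then f^q(x) <= x + p for all x, and the average
   h = (1/q) sum_(i < q) f^i satisfies h o f <= h + p/q, that is,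
   f <= h^-1 R_(p/q) h.  For a positive word w, rot(w(f, g)) is monotone in f
   and g, so the supremum over conjugates of R_(p/q) bounds R(w, r, s) for
   every r < p/q.  Conversely h^-1 R_(p/q) h is the limit of h^-1 R_r h as r
   increases to p/q, and rot is lower semicontinuous because f^m(0) determines
   m rot(f) up to an error of 1. *)
Require Import Defs.
From HB Require Import structures.
From mathcomp Require Import all_boot all_order all_algebra.
From mathcomp Require Import all_classical all_reals all_analysis.
Import Order.TTheory GRing.Theory Num.Theory numFieldNormedType.Exports.
From mathcomp Require Import lra.

Local Open Scope classical_set_scope.
Local Open Scope ring_scope.

(** * Evaluation of words in a group and the universal property of the free group *)

Section WordEvaluation.
Context {X : choiceType} {G : groupType}.
Implicit Types (e : X -> G) (l : letter X) (s t : seq (letter X)).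

Definition eval_letter e l : G := (if l.2 then (e l.1)^-1 else e l.1)%g.

Definition eval_word e s : G :=
  foldr (fun l g => (eval_letter e l * g)%g) 1%g s.

Lemma eval_letter_linv e l : eval_letter e (linv l) = ((eval_letter e l)^-1)%g.
Proof. by case: l => x []; rewrite /eval_letter //= invgK. Qed.

(** A cancellation made by [lcons] becomes a product of an element and its inverse in [G], so
    reduction does not change the value. *)
Lemma eval_word_lcons e l s :
  eval_word e (lcons l s) = (eval_letter e l * eval_word e s)%g.
Proof.
case: s => [//|m s] /=; case: eqVneq => [->|//].
by rewrite eval_letter_linv mulVKg.
Qed.

Lemma eval_word_lcat e s t :
  eval_word e (lcat s t) = (eval_word e s * eval_word e t)%g.
Proof.
elim: s => [|l s IH] /=; first by rewrite mul1g.
by rewrite eval_word_lcons IH mulgA.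
Qed.

Definition eval_freegroup e (u : freegroup X) : G := eval_word e u.

Fact eval_freegroupM e : {morph eval_freegroup e : u v / (u * v)%g}.
Proof. by move=> u v; exact: eval_word_lcat. Qed.

HB.instance Definition _ e :=
  isMultiplicative.Build (freegroup X) G (eval_freegroup e) (eval_freegroupM e).

Lemma eval_freegroup_gen e x : eval_freegroup e (fgen x) = e x.
Proof. by rewrite /eval_freegroup /= mulg1. Qed.

Lemma multiplicative1 {H : groupType} (f : {multiplicative H -> G}) :
  f 1%g = 1%g.
Proof. by apply: (mulgI (f 1%g)); rewrite -gmulfM !mulg1. Qed.

Lemma multiplicativeV {H : groupType} (f : {multiplicative H -> G}) x :
  f (x^-1)%g = ((f x)^-1)%g.
Proof. by apply: (mulgI (f x)); rewrite -gmulfM !mulgV multiplicative1. Qed.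

Lemma multiplicative_eval (rho : {multiplicative freegroup X -> G}) u :
  rho u = eval_word (rho \o @fgen X) u.
Proof.
case: u => s rs /=; elim: s rs => [|l s IH] rs /=.
  rewrite (_ : Freegroup rs = 1%g) ?multiplicative1//; exact: val_inj.
have rs' : reduced s := path_sorted rs.
have rl : reduced [:: l] by [].
(* Since [l :: s] is reduced, [lcons l s] cancels nothing and the product is plain concatenation. *)
have -> : Freegroup rs = (Freegroup rl * Freegroup rs')%g.
  apply: val_inj => /=; case: s rs {IH rs'} => //= m s.
  by move=> /andP[/negbTE ->].
rewrite gmulfM IH; congr (_ * _)%g; rewrite /eval_letter /=.
case: l rl {rs} => x [] rl /=; last by congr (rho _); exact: val_inj.
by rewrite -multiplicativeV; congr (rho _); exact: val_inj.
Qed.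

End WordEvaluation.

(** * Basic properties of lifts of circle homeomorphisms *)

Section Homeo.
Variable R : realType.
Implicit Types (f g h : homeoS1 R) (x y r : R).

Lemma homeoS1_mulE f g x : (f * g)%g x = f (g x).
Proof. by []. Qed.

Lemma homeoS1_continuous f : continuous (f : R -> R).
Proof. by have [[? [] ]] := homeoS1P f. Qed.

Lemma homeoS1_le f : {mono f : x y / x <= y}.
Proof. by have [_ flt _] := homeoS1P f; apply: le_mono. Qed.

Lemma homeoS1_add1 f x : f (x + 1) = f x + 1.
Proof. by have [_ _ ->] := homeoS1P f. Qed.

(** Integer shifts make [h] unbounded both ways, so the intermediate value theorem gives
    surjectivity. The inverse is continuous because [y] lies strictly between [h (g y - e)] and
    [h (g y + e)]. *)
Lemma homeoS1_axiom_continuous (h : R -> R) :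
  continuous h -> {homo h : x y / x < y} -> (forall x, h (x + 1) = h x + 1) ->
  homeoS1_axiom h.
Proof.
move=> ch hlt h1.
have hn (n : nat) y : h (y + n%:R) = h y + n%:R.
  by elim: n => [|n IH]; rewrite ?addr0// -natr1 !addrA h1 IH.
have hle : {mono h : x y / x <= y} by exact: le_mono.
have surj y : exists x, h x = y.
  pose n := Num.bound `|y - h 0|.
  have nP : `|y - h 0| < n%:R by apply: archi_boundP; exact: normr_ge0.
  have h0 : h (- n%:R) + n%:R = h 0 by rewrite -hn addNr.
  have hN := hn n 0; rewrite add0r in hN.
  move: nP; rewrite ltr_norml => /andP[n1 n2].
  have ab : - n%:R <= n%:R :> R by rewrite ge0_cp.
  have [||c _ hc] := @IVT R h (- n%:R) n%:R y ab.
  - exact: continuous_subspaceT.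
  - rewrite min_l ?max_r ?hle//; apply/andP; split; lra.
  - by exists c.
pose g y := sval (cid (surj y)).
have gK : cancel g h by move=> y; exact: svalP (cid (surj y)).
have hK : cancel h g by apply: (inj_can_sym gK); exact: inc_inj.
split => //; exists g; split => // y.
have hltm : {mono h : x y / x < y} := leW_mono hle.
apply/cvgrPdist_lt => e e0.
have l1 : h (g y - e) < y by rewrite -[ltRHS]gK hltm; lra.
have l2 : y < h (g y + e) by rewrite -[ltLHS]gK hltm; lra.
near=> z.
have z1 : h (g y - e) < z by near: z; exact: lt_nbhsr.
have z2 : z < h (g y + e) by near: z; exact: lt_nbhsl.
move: z1 z2; rewrite -{1 2}[z]gK !hltm => z1 z2.
by rewrite ltr_norml; apply/andP; split; lra.
Unshelve. all: by end_near. Qed.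

(** * The pointwise order and monotonicity of positive words *)

Definition ple f g := forall x, f x <= g x.

Lemma ple_refl f : ple f f. Proof. by move=> x. Qed.

Lemma ple_mul f f' g g' : ple f f' -> ple g g' -> ple (f * g)%g (f' * g')%g.
Proof.
by move=> ff' gg' x; rewrite !homeoS1_mulE (le_trans (ff' _))// homeoS1_le.
Qed.

Lemma ple_exp f f' n : ple f f' -> ple (f ^+ n)%g (f' ^+ n)%g.
Proof.
move=> ff'; elim: n => [|n IH]; first exact: ple_refl.
by rewrite !expgS; exact: ple_mul.
Qed.

(** Inversion reverses [ple]; a positive word only composes increasing maps, which respects it. *)
Lemma ple_eval_word {X : choiceType} (e e' : X -> homeoS1 R) s :
  all (fun l : letter X => ~~ l.2) s -> (forall i, ple (e i) (e' i)) ->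
  ple (eval_word e s) (eval_word e' s).
Proof.
move=> + ee'; elim: s => [_|[x []] s IH] //=.
by move=> /IH; apply: ple_mul; exact: ee'.
Qed.

(** * Estimates for rotation numbers *)

Lemma rotnum_ple f g : ple f g -> rotnum f <= rotnum g.
Proof.
move=> fg; apply: (ler_cvg_to (@rot_cvg R f 0) (@rot_cvg R g 0)).
apply: nearW => n; rewrite ler_wpM2r ?invr_ge0// lerB//.
exact: ple_exp.
Qed.

(** Let [n] tend to infinity in [rot_seq_cauchy]. A single iterate at 0 thus controls the rotation
    number. *)
Lemma rotnum_dist f m : (0 < m)%N ->
  `|rotnum f - (f ^+ m)%g 0 / m%:R| <= m%:R^-1.
Proof.
move=> m0.
have inv0 : (fun n : nat => (n%:R : R)^-1) @ \oo --> (0 : R).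
  by rewrite -(cvg_shiftS (fun n => (n%:R : R)^-1)); exact: cvg_harmonic.
have c1 : (fun n : nat => `|((f ^+ n)%g 0 - 0) / n%:R - (f ^+ m)%g 0 / m%:R|)
    @ \oo --> `|rotnum f - (f ^+ m)%g 0 / m%:R|.
  by apply: cvg_norm; apply: cvgB; [exact: rot_cvg|exact: cvg_cst].
have c2 : (fun n : nat => (n%:R : R)^-1 + m%:R^-1) @ \oo --> 0 + (m%:R : R)^-1.
  by apply: cvgD => //; exact: cvg_cst.
rewrite -[leRHS]add0r; apply: ler_cvg_to c1 c2 _.
by exists 1%N => // n /= n1; rewrite subr0; exact: rot_seq_cauchy.
Qed.

Lemma rotnum_eq_bounded f r (C : R) :
  (forall n, `|(f ^+ n)%g 0 - n%:R * r| <= C) -> rotnum f = r.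
Proof.
move=> fC; apply/eqP; rewrite -subr_eq0 -normr_le0; apply/ler_addgt0Pl => e e0.
rewrite addr0.
have C0 : 0 <= C by apply: le_trans (fC 0%N).
(* [C] bounds the drift of [(f ^+ m) 0] from [m r], and 1 is [m] times the error in [rotnum_dist];
   [.+1] keeps [m] positive. *)
pose m := (Num.bound `|(C + 1) / e|).+1.
have m0 : 0 < m%:R :> R by rewrite ltr0n.
have hm : C + 1 <= m%:R * e.
  rewrite -ler_pdivrMr//; apply: ltW; apply: le_lt_trans (ler_norm _) _.
  by apply: lt_le_trans (archi_boundP _) _; rewrite ?normr_ge0// ler_nat.
rewrite -(ler_pM2l m0); apply: le_trans hm.
have := @rotnum_dist f m isT; rewrite -(ler_pM2l m0) mulfV ?gt_eqF//.
rewrite -{1 3}[m%:R]gtr0_norm// -!normrM !mulrBr mulrCA mulfV ?gt_eqF// mulr1.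
by have := fC m; rewrite !ler_norml => /andP[? ?] /andP[? ?]; apply/andP; split; lra.
Qed.

Lemma translationX r n : (translation r ^+ n)%g = translation (n%:R * r).
Proof.
apply: homeoS1_eq; elim: n => [|n IH] x; first by rewrite /= mul0r addr0.
by rewrite expgS homeoS1_mulE IH /= -natr1; lra.
Qed.

Lemma rotnum_conj_translation r h : rotnum (translation r ^ h)%g = r.
Proof.
apply: (@rotnum_eq_bounded _ _ 1) => n; rewrite -conjXg translationX.
rewrite conjgE !homeoS1_mulE /=.
(* The displacements of [h^-1] at these two points differ by at most 1, so the iterates of the
   conjugate stay within 1 of those of the translation. *)
have := homeoS1_displacement (h^-1)%g (h 0 + n%:R * r) (h 0).
rewrite -[(h^-1)%g (h 0)]/((h^-1 * h)%g 0) mulVg /= !ler_norml.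
by move=> /andP[? ?]; apply/andP; split; lra.
Qed.

Lemma rotnum_translation r : rotnum (translation r) = r.
Proof. by rewrite -[translation r]conjg1 rotnum_conj_translation. Qed.

Lemma conjugated_translation_rotnum f r :
  conjugated f (translation r) -> rotnum f = r.
Proof. by move=> [h ->]; exact: rotnum_conj_translation. Qed.

Lemma conjugated_refl f : conjugated f f.
Proof. by exists 1%g; rewrite conjg1. Qed.

(** One unit comes from comparing the displacements at [x] and 0, the other from [rotnum_dist] with
    [m = 1]. This bounds the suprema below. *)
Lemma ple_rotnum_translation f : ple f (translation (rotnum f + 2)).
Proof.
move=> x; rewrite /=; have := @rotnum_dist f 1 isT.
have := homeoS1_displacement f x 0.
rewrite expg1 invr1 mulr1 !ler_norml => /andP[? ?] /andP[? ?]; lra.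
Qed.

(** * Domination by conjugates of rational rotations *)

Lemma iter_bound_of_rotnum_lt f (p : int) (q : nat) x : (0 < q)%N ->
  rotnum f < p%:~R / q%:R -> (f ^+ q)%g x <= x + p%:~R.
Proof.
move=> q0 fpq; rewrite leNgt; apply/negP => xp.
have q0' : 0 < q%:R :> R by rewrite ltr0n.
(* A single point moved beyond [x + p] propagates along its orbit, as [f ^+ q] is increasing and
   commutes with integer shifts; this forces rotation number at least [p / q]. *)
have iter_ge n : x + n%:R * p%:~R <= ((f ^+ q) ^+ n)%g x.
  elim: n => [|n IH]; first by rewrite mul0r addr0.
  rewrite expgS homeoS1_mulE.
  have np : n%:R * p%:~R = (n%:Z * p)%:~R :> R by rewrite intrM.
  move: IH; rewrite -(homeoS1_le (f ^+ q)%g) [in X in X -> _]np homeoS1_addz -np.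
  by apply: le_trans; rewrite -natr1; lra.
pose d := p%:~R / q%:R - rotnum f.
have d0 : 0 < d by rewrite subr_gt0.
(* The total gap [n q d] must exceed 2: one unit is lost in moving from [x] to 0, one in
   [rotnum_dist]. *)
pose n := (Num.bound `|2 / (q%:R * d)|).+1.
have n0 : 0 < n%:R :> R by rewrite ltr0n.
have hn : 2 < n%:R * (q%:R * d).
  rewrite -ltr_pdivrMr ?mulr_gt0//; apply: le_lt_trans (ler_norm _) _.
  by apply: lt_le_trans (archi_boundP _) _; rewrite ?normr_ge0// ler_nat.
have qn0 : (0 < q * n)%N by rewrite muln_gt0 q0.
have := rotnum_dist f _ qn0; have := iter_ge n.
have := homeoS1_displacement (f ^+ (q * n))%g x 0.
rewrite expgnA natrM.
set F := ((f ^+ q) ^+ n)%g; rewrite !ler_norml => /andP[_ D] I /andP[E _].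
have {}E : F 0 - 1 <= q%:R * n%:R * rotnum f.
  have qn : 0 < q%:R * n%:R :> R by rewrite mulr_gt0.
  by rewrite mulrC -ler_pdivrMr// mulrBl mul1r; lra.
have hd : n%:R * (q%:R * d) = n%:R * p%:~R - q%:R * n%:R * rotnum f.
  have qp : q%:R * (p%:~R / q%:R) = p%:~R :> R by rewrite mulrC divfK ?gt_eqF.
  by rewrite /d !mulrBr qp; lra.
lra.
Qed.

Fact orbit_sum_axiom f q : (0 < q)%N ->
  homeoS1_axiom (fun x => (\sum_(0 <= i < q) (f ^+ i)%g x) / q%:R).
Proof.
move=> q0; have q0' : 0 < q%:R :> R by rewrite ltr0n.
apply: homeoS1_axiom_continuous.
- move=> x; apply: cvgM; last exact: cvg_cst.
  by apply: cvg_big => [|i _]; [exact: add_continuous|exact: homeoS1_continuous].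
- move=> x y xy; rewrite ltr_pM2r ?invr_gt0//.
  (* The term [i = 0] is the identity and gives strictness; the other terms need only be
     nondecreasing. *)
  case: q q0 {q0'} => // q _; rewrite !big_nat_recl//= ltr_leD//.
  by apply: ler_sum => i _; rewrite homeoS1_le ltW.
- move=> x; under eq_bigr do rewrite homeoS1_add1.
  by rewrite big_split/= sumr_const_nat subn0 mulrDl divff ?gt_eqF.
Qed.

Lemma ple_conj_translation f (p : int) (q : nat) : (0 < q)%N ->
  (forall x, (f ^+ q)%g x <= x + p%:~R) ->
  exists h, ple f (translation (p%:~R / q%:R) ^ h)%g.
Proof.
move=> q0 fq; have q0' : 0 < q%:R :> R by rewrite ltr0n.
pose h := HomeoS1 (asboolT (orbit_sum_axiom f _ q0)).
exists h => x; rewrite -(homeoS1_le h) conjgE -[leRHS]homeoS1_mulE mulVKg.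
rewrite homeoS1_mulE /= -mulrDl ler_pM2r ?invr_gt0//.
(* After applying [h] on both sides, the sums at [f x] and at [x] differ by a telescoping sum equal
   to [(f ^+ q) x - x], which is at most [p]. *)
rewrite -lerBlDl -sumrB.
rewrite (eq_bigr (fun i => (f ^+ i.+1)%g x - (f ^+ i)%g x)).
  by rewrite (telescope_sumr (fun i => (f ^+ i)%g x))// lerBlDl; exact: fq.
by move=> i _; rewrite expgSr.
Qed.

Lemma rotnum_lt_ple f (p : int) (q : nat) : (0 < q)%N ->
  rotnum f < p%:~R / q%:R ->
  exists2 f', conjugated f' (translation (p%:~R / q%:R)) & ple f f'.
Proof.
move=> q0 fpq; have [|h fh] := ple_conj_translation f p q q0.
  by move=> x; exact: iter_bound_of_rotnum_lt.
by exists (translation (p%:~R / q%:R) ^ h)%g => //; exists h.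
Qed.

(** * Convergence of homeomorphisms and lower semicontinuity of the rotation number *)

Section Convergence.
Context {T : Type} {F : set_system T} {FF : ProperFilter F}.
Implicit Types (u v : T -> homeoS1 R).

(* Pointwise convergence along moving base points, which composes; for
   homeomorphisms it amounts to locally uniform convergence. *)
Definition continuous_cvg_to u f := forall (y : T -> R) y0,
  y t @[t --> F] --> y0 -> u t (y t) @[t --> F] --> f y0.

Lemma continuous_cvg_to_cst f : continuous_cvg_to (fun=> f) f.
Proof. by move=> y y0; apply: continuous_cvg; exact: homeoS1_continuous. Qed.

Lemma continuous_cvg_to_mul u v f g :
  continuous_cvg_to u f -> continuous_cvg_to v g ->
  continuous_cvg_to (fun t => (u t * v t)%g) (f * g)%g.
Proof. by move=> uf vg y y0 /vg/uf. Qed.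

Lemma continuous_cvg_to_exp u f n : continuous_cvg_to u f ->
  continuous_cvg_to (fun t => (u t ^+ n)%g) (f ^+ n)%g.
Proof.
move=> uf; elim: n => [|n IH]; first exact: continuous_cvg_to_cst.
rewrite expgS; under eq_fun do rewrite expgS.
exact: continuous_cvg_to_mul.
Qed.

Lemma continuous_cvg_to_eval_word {X : choiceType} (e : T -> X -> homeoS1 R)
    (e0 : X -> homeoS1 R) s :
  all (fun l : letter X => ~~ l.2) s ->
  (forall i, continuous_cvg_to (e ^~ i) (e0 i)) ->
  continuous_cvg_to (fun t => eval_word (e t) s) (eval_word e0 s).
Proof.
move=> + ee0; elim: s => [_|[x []] s IH] //=.
by move=> /IH; apply: continuous_cvg_to_mul; exact: ee0.
Qed.

Lemma continuous_cvg_to_conj_translation (c : T -> R) r h :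
  c t @[t --> F] --> r ->
  continuous_cvg_to (fun t => (translation (c t) ^ h)%g) (translation r ^ h)%g.
Proof.
move=> cr; apply: continuous_cvg_to_mul; first exact: continuous_cvg_to_cst.
apply: continuous_cvg_to_mul; last exact: continuous_cvg_to_cst.
by move=> y y0 yy0; exact: cvgD.
Qed.

Lemma rotnum_lower_semicontinuous u f e :
  continuous_cvg_to u f -> 0 < e -> \forall t \near F, rotnum f - e < rotnum (u t).
Proof.
move=> uf e0.
(* Three unit errors arise after scaling by [m]: one for each of [f] and [u t] between [m] times the
   rotation number and the iterate at 0, and one between the two iterates. *)
pose m := (Num.bound `|3 / e|).+1.
have m0 : 0 < m%:R :> R by rewrite ltr0n.
have hm : 3 < m%:R * e.
  rewrite -ltr_pdivrMr//; apply: le_lt_trans (ler_norm _) _.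
  by apply: lt_le_trans (archi_boundP _) _; rewrite ?normr_ge0// ler_nat.
have scaled g : `|m%:R * rotnum g - (g ^+ m)%g 0| <= 1.
  have := rotnum_dist g m isT; rewrite -(ler_pM2l m0) mulfV ?gt_eqF//.
  rewrite -{1}[m%:R]gtr0_norm// -normrM mulrBr mulrCA mulfV ?gt_eqF//.
  by rewrite mulr1.
have um : (u t ^+ m)%g 0 @[t --> F] --> (f ^+ m)%g 0.
  exact: continuous_cvg_to_exp (cvg_cst _).
have /cvgrPdist_lt/(_ _ ltr01) := um; apply: filterS => t.
have := scaled f; have := scaled (u t).
rewrite !ler_norml ltr_norml => /andP[? ?] /andP[? ?] /andP[? ?].
by rewrite -(ltr_pM2l m0) mulrBr; lra.
Qed.

(** * Limits of suprema over representations *)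

Definition word_rotnums (w : F2) (A B : set (homeoS1 R)) : set R :=
  [set rotnum (rho w) | rho in [set rho : {multiplicative F2 -> homeoS1 R} |
    A (rho gen_a) /\ B (rho gen_b)]].

Definition eval_pair f g : F2 -> homeoS1 R :=
  eval_word (fun i : bool => if i then g else f).

(** Freeness turns the supremum over homomorphisms into one over pairs [(f, g)], chosen
    independently in [A] and [B]. *)
Lemma mem_word_rotnums w (A B : set (homeoS1 R)) z :
  word_rotnums w A B z <->
  exists f g, [/\ A f, B g & z = rotnum (eval_pair f g w)].
Proof.
split=> [[rho [Af Bg] <-]|[f [g [Af Bg ->]]]].
  exists (rho gen_a), (rho gen_b); split => //.
  by rewrite multiplicative_eval; congr (rotnum (eval_word _ _));
    apply/funext => -[].
exists (eval_freegroup (fun i : bool => if i then g else f)) => //=.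
by rewrite !eval_freegroup_gen.
Qed.

Lemma rotnum_eval_pair_ple w f f' g g' : positive_word w ->
  ple f f' -> ple g g' ->
  rotnum (eval_pair f g w) <= rotnum (eval_pair f' g' w).
Proof.
by move=> w0 ff' gg'; apply/rotnum_ple/ple_eval_word => // -[].
Qed.

(** The first two clauses make the limiting supremum finite, the third bounds nearby suprema above
    by it, the fourth bounds them below in the limit. Fixed and varying generators both fit, so one
    lemma yields all three limits. *)
Definition approximates (A : T -> set (homeoS1 R)) (A0 : set (homeoS1 R)) :=
  [/\ A0 !=set0,
      exists g, forall f, A0 f -> ple f g,
      \forall t \near F, forall f, A t f -> exists2 f', A0 f' & ple f f' &
      forall f, A0 f -> exists u,
        (\forall t \near F, A t (u t)) /\ continuous_cvg_to u f].

Lemma cvg_sup_word_rotnums w A B A0 B0 : positive_word w ->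
  approximates A A0 -> approximates B B0 ->
  sup (word_rotnums w (A t) (B t)) @[t --> F] --> sup (word_rotnums w A0 B0).
Proof.
move=> w0 [[fa A0f] [f1 Af1] Aup Alow] [[gb B0g] [g1 Bg1] Bup Blow].
have S0sup : has_sup (word_rotnums w A0 B0).
  split; first by eexists; apply/mem_word_rotnums; exists fa, gb.
  exists (rotnum (eval_pair f1 g1 w)) => _ /mem_word_rotnums[f [g [Af Bg ->]]].
  by apply: rotnum_eval_pair_ple; [|exact: Af1|exact: Bg1].
apply/cvgrPdist_le => e e0; have e2 : 0 < e / 2 by rewrite divr_gt0.
(* A nearly optimal pair costs [e / 2]; semicontinuity along its approximants costs the other
   half. *)
have [_ /mem_word_rotnums[f [g [Af Bg ->]]] fge] := sup_adherent e2 S0sup.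
have [u [Au uf]] := Alow _ Af; have [v [Bv vg]] := Blow _ Bg.
have W : continuous_cvg_to (fun t => eval_pair (u t) (v t) w) (eval_pair f g w).
  by apply: continuous_cvg_to_eval_word => // -[].
have Wlow := rotnum_lower_semicontinuous _ _ _ W e2.
near=> t.
have Stub : ubound (word_rotnums w (A t) (B t)) (sup (word_rotnums w A0 B0)).
  move=> _ /mem_word_rotnums[f' [g' [Af' Bg' ->]]].
  have At : forall f, A t f -> exists2 f', A0 f' & ple f f' by near: t.
  have Bt : forall f, B t f -> exists2 f', B0 f' & ple f f' by near: t.
  have [f2 Af2 ff2] := At _ Af'; have [g2 Bg2 gg2] := Bt _ Bg'.
  apply: le_trans (rotnum_eval_pair_ple _ _ _ _ _ w0 ff2 gg2) _.
  by apply: sup_upper_bound => //; apply/mem_word_rotnums; exists f2, g2.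
have St : word_rotnums w (A t) (B t) (rotnum (eval_pair (u t) (v t) w)).
  by apply/mem_word_rotnums; exists (u t), (v t); split => //; near: t.
have le1 : sup (word_rotnums w (A t) (B t)) <= sup (word_rotnums w A0 B0).
  by apply: ge_sup => //; eexists; exact: St.
have le2 : rotnum (eval_pair (u t) (v t) w) <= sup (word_rotnums w (A t) (B t)).
  by apply: ub_le_sup => //; eexists; exact: Stub.
have lt3 : rotnum (eval_pair f g w) - e / 2 < rotnum (eval_pair (u t) (v t) w).
  by near: t.
by rewrite ler_norml; apply/andP; split; lra.
Unshelve. all: by end_near. Qed.

Lemma approximates_rotnum_cst r :
  approximates (fun=> [set f | rotnum f = r]) [set f | rotnum f = r].
Proof.
split.
- by exists (translation r); exact: rotnum_translation.
- by exists (translation (r + 2)) => f /= <-; exact: ple_rotnum_translation.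
- by apply: nearW => t f rf; exists f => //; exact: ple_refl.
- move=> f rf; exists (fun=> f); split; first exact: nearW.
  exact: continuous_cvg_to_cst.
Qed.

(** [rotnum_lt_ple] gives domination by the conjugacy class. Conversely, keeping the conjugator [h]
    and replacing the angle by [c t] gives approximants of rotation number exactly [c t]. *)
Lemma approximates_rotnum_left (p : int) (q : nat) (c : T -> R) : (0 < q)%N ->
  c t @[t --> F] --> (p%:~R / q%:R : R) ->
  (\forall t \near F, c t < p%:~R / q%:R) ->
  approximates (fun t => [set f | rotnum f = c t])
    [set f | conjugated f (translation (p%:~R / q%:R))].
Proof.
move=> q0 cpq cltpq; split.
- by exists (translation (p%:~R / q%:R)); exact: conjugated_refl.
- exists (translation (p%:~R / q%:R + 2)) => f.
  by move=> /conjugated_translation_rotnum <-; exact: ple_rotnum_translation.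
- apply: filterS cltpq => t ct f /= fc; apply: rotnum_lt_ple => //.
  by rewrite fc.
- move=> _ [h ->]; exists (fun t => translation (c t) ^ h)%g; split.
    by apply: nearW => t; exact: rotnum_conj_translation.
  exact: continuous_cvg_to_conj_translation.
Qed.

End Convergence.

End Homeo.

Theorem proposition3p15 (R : realType) (w : F2) (p1 p2 : int) (q1 q2 : nat)
    (hw : positive_word w) (hq1 : (0 < q1)%N) (hq2 : (0 < q2)%N) :
  let r1 : R := p1%:~R / q1%:R in
  let r2 : R := p2%:~R / q2%:R in
  [/\ maxrot w r r2 @[r --> r1^'-] -->
        sup [set rotnum (rho w) | rho in [set rho : {multiplicative F2 -> homeoS1 R} |
          conjugated (rho gen_a) (translation r1) /\ rotnum (rho gen_b) = r2]],
      maxrot w r1 s @[s --> r2^'-] -->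
        sup [set rotnum (rho w) | rho in [set rho : {multiplicative F2 -> homeoS1 R} |
          rotnum (rho gen_a) = r1 /\ conjugated (rho gen_b) (translation r2)]]
    & maxrot w x.1 x.2 @[x --> filter_prod r1^'- r2^'-] -->
        sup [set rotnum (rho w) | rho in [set rho : {multiplicative F2 -> homeoS1 R} |
          conjugated (rho gen_a) (translation r1) /\
          conjugated (rho gen_b) (translation r2)]]].
Proof.
move=> r1 r2.
have lt1 : \forall r \near r1^'-, r < r1 := nbhs_left_lt r1.
have lt2 : \forall r \near r2^'-, r < r2 := nbhs_left_lt r2.
have cvg1 : r @[r --> r1^'-] --> r1 by apply: cvg_within.
have cvg2 : r @[r --> r2^'-] --> r2 by apply: cvg_within.
have cvg1' : x.1 @[x --> filter_prod r1^'- r2^'-] --> r1.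
  by apply: cvg_trans cvg1; exact: cvg_app cvg_fst.
have cvg2' : x.2 @[x --> filter_prod r1^'- r2^'-] --> r2.
  by apply: cvg_trans cvg2; exact: cvg_app cvg_snd.
have lt1' : \forall x \near filter_prod r1^'- r2^'-, x.1 < r1 .
  exact: (cvg_fst lt1).
have lt2' : \forall x \near filter_prod r1^'- r2^'-, x.2 < r2 .
  exact: (cvg_snd lt2).
(* [maxrot] unfolds to the supremum of [word_rotnums] over two level sets of [rotnum], so each limit
   is an instance of [cvg_sup_word_rotnums]. *)
split.
- exact: (cvg_sup_word_rotnums R w _ _ _ _ hw
    (approximates_rotnum_left R p1 q1 _ hq1 cvg1 lt1)
    (approximates_rotnum_cst R r2)).
- exact: (cvg_sup_word_rotnums R w _ _ _ _ hw
    (approximates_rotnum_cst R r1)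
    (approximates_rotnum_left R p2 q2 _ hq2 cvg2 lt2)).
- exact: (cvg_sup_word_rotnums R w _ _ _ _ hw
    (approximates_rotnum_left R p1 q1 _ hq1 cvg1' lt1')
    (approximates_rotnum_left R p2 q2 _ hq2 cvg2' lt2')).
Qed.
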